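(* Assume that $(\Xi,\mathcal A,m)$ is a complete $\sigma$-finite measure space and $X$ is a Suslin space. Let $h:\Xi\times X\to\overline{\mathbb R}$ be $\mathcal A\otimes\mathcal B(X)$-measurable. Then, for every decomposable $\mathcal X\subset L^0(\Xi;X)$, $$\inf_{x\in\mathcal X}\int h(\xi,x(\xi))\,dm(\xi)=\int\inf_{x\in X}h(\xi,x)\,dm(\xi)$$ as soon as the left side is less than $+\infty$.
   Context: $\overline{\mathbb R}=[-\infty,+\infty]$. $\mathcal B(X)$ is the Borel $\sigma$-algebra of $X$ and $L^0(\Xi;X)$ is the space of measurable functions from $\Xi$ to $X$. An integral is defined as $+\infty$ unless the positive part is integrable. A set $\mathcal X\subset L^0(\Xi;X)$ is decomposable if, for every $x\in\mathcal X$, the function equal to $\bar x$ on $A$ and to $x$ on $A^c$ (written $1_A\bar x+1_{A^C}x$) belongs to $\mathcal X$ whenever $A\in\mathcal A$ with $m(A)<\infty$ and $\bar x\in L^0(\Xi;X)$ is such that the closure of the range of $\bar x$ is compact. $X$ is not assumed to be a topological vector space. *)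

(* Defs.v *)
(* MathComp / MathComp-Analysis *)
From HB Require Import structures.
From mathcomp Require Import all_boot all_order all_algebra.
From mathcomp Require Import all_classical all_reals all_analysis.
From mathcomp Require Import measurable_realfun.

Set Implicit Arguments.
Unset Strict Implicit.
Unset Printing Implicit Defensive.

Import Order.TTheory GRing.Theory Num.Theory.
Local Open Scope classical_set_scope.
Local Open Scope ring_scope.
Local Open Scope ereal_scope.

(* The library's measurable types are pointed, hence [ptopologicalType]. *)
Notation borelType X := (g_sigma_algebraType (@open X)).

(* Completeness is spelled out, instead of using [completePseudoMetricType],
   because the latter is pointed. *)
Definition complete_metric (R : realType) (P : metricType R) : Prop :=
  forall F : set_system P, ProperFilter F -> cauchy F ->
    exists p : P, F --> p.

Definition separable (T : topologicalType) : Prop :=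
  exists2 D : set T, countable D & dense D.

(* All real types being isomorphic, the notion does not depend on [R]. *)
Definition suslin_space (R : realType) (X : topologicalType) : Prop :=
  hausdorff_space X /\
  exists P : metricType R,
    [/\ complete_metric P, separable P &
        exists f : P -> X, continuous f /\ range f = setT].

(* Functions, not classes of functions modulo almost everywhere equality. *)
Definition L0 d (T : measurableType d) (X : ptopologicalType) : set (T -> X) :=
  [set x | measurable_fun setT (x : T -> borelType X)].

(* [patch x A xbar] is the function equal to [xbar] on [A] and to [x] on the
   complement of [A]. *)
Definition decomposable d (T : measurableType d) (R : realType)
    (m : {measure set T -> \bar R}) (X : ptopologicalType)
    (XX : set (T -> X)) : Prop :=
  forall x : T -> X, XX x ->
  forall A : set T, measurable A -> m A < +oo ->
  forall xbar : T -> X, L0 xbar -> compact (closure (range xbar)) ->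
    XX (patch x A xbar).

(* The library integral is the difference of the integrals of the positive and
   negative parts, with the convention +oo - +oo = -oo; here the value is +oo
   whenever the positive part is not integrable. *)
Definition upper_integral d (T : measurableType d) (R : realType)
    (m : {measure set T -> \bar R}) (f : T -> \bar R) : \bar R :=
  if m.-integrable setT (f^\+) then \int[m]_t f t else +oo.

(* Main.v *)
Require Import Defs.
From HB Require Import structures.
From mathcomp Require Import all_boot all_order all_algebra.
From mathcomp Require Import all_classical all_reals all_analysis.
From mathcomp Require Import measurable_realfun.
From mathcomp Require Import lra.

Import Order.TTheory GRing.Theory Num.Theory.
Local Open Scope classical_set_scope.
Local Open Scope ring_scope.
Local Open Scope ereal_scope.

Set Implicit Arguments.
Unset Strict Implicit.
Unset Printing Implicit Defensive.

(** The inequality >= is monotonicity of the integral.  For <=, given a real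
    number [b] above the integral of [p xi = inf_x h (xi, x)], one needs a
    member [x] of the decomposable family with integral at most [b].  The
    natural candidate is a measurable selection of [{(xi, y) | h (xi, y) <=
    q xi}], where [q] is slightly larger than [p]; decomposability only allows
    such a selection to be pasted into a given member [x0] over a set of
    finite measure, and only if its values stay in a compact set.

    Everything measure-theoretic comes from one statement about the Souslin
    operation on a space with a finite measure [mu] ([not_covered_extendible]).
    The outer measure is continuous along increasing sequences, so if the
    Souslin set of a scheme [A] has outer measure larger than [c], one can
    choose successively bounds [b 0], [b 1], ... such that the branches bounded
    by [b] still account for outer measure larger than [c].  By Koenig's lemma
    the points that have a branch bounded by [b] form a measurable set, hence
    one of measure at least [c], and the leftmost bounded branch depends
    measurably on the point.  This gives at once
    - measurability of Souslin sets for a complete measure, that is, the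
      projection theorem ([measurable_projection]) and measurability of [p];
    - selections defined up to a set of small measure whose values lie in a
      compact set ([approximate_selection]): branches bounded by [b] form a
      compact subset of the Baire space.
    The space [X] enters only through a continuous map from the Baire space
    onto it ([suslin_parametrization]); sets in the product sigma-algebra are
    pulled back along it to sets of the form
    [{(t, al) | exists be, forall n, A (al|n) (be|n) t}], a class that is stable
    under countable unions and intersections ([bisouslin_graph_preimage]).

    For the integrals ([near_optimal_selection]), let [w > 0] be integrable and
    [a = max (p, - n w)].  Monotone convergence provides [n] such that the
    integral of [a] is below [b], and [q = a + e w] exceeds [p] strictly where
    [p < +oo].  The finite measure with density [u = h (., x0)^+ + w] is used in
    the selection statement: if the selection is pasted into [x0] over [A], the
    resulting integrand is at most [a + e w + (n + 1) u 1_(~A)], whose integral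
    exceeds that of [a] by as little as desired. *)

(** * Branches of a Souslin scheme and outer measure *)

(** An upper bound on the outer measure of [S], phrased without naming the
    outer measure. *)
Definition covered (R : realType) d (T : measurableType d)
    (mu : {measure set T -> \bar R}) (c : \bar R) (S : set T) : Prop :=
  exists H, [/\ measurable H, S `<=` H & mu H <= c].

(** Continuity from below of the outer measure.  Covers [H k] of the [S k] need
    not increase, but the intersection of the [H k] with [i <= k] still covers
    [S i], has measure at most [c], and increases with [i]. *)
Lemma covered_bigcup (R : realType) d (T : measurableType d)
    (mu : {measure set T -> \bar R}) (c : \bar R) (S : nat -> set T) :
  (forall i j, (i <= j)%N -> S i `<=` S j) ->
  (forall i, covered mu c (S i)) -> covered mu c (\bigcup_i S i).
Proof.
move=> Smono /choice[H HP].
pose G i := \bigcap_(k in [set k | (i <= k)%N]) H k.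
have mG i : measurable (G i).
  by apply: bigcap_measurable => [|k _]; [exists i => /= | case: (HP k)].
exists (\bigcup_i G i); split.
- exact: bigcupT_measurable.
- move=> t [i _ Sit]; exists i => // k /= ik.
  by case: (HP k) => _ + _; apply; exact: Smono Sit.
- have ndG : nondecreasing_seq G.
    by move=> i j ij; apply/subsetPset => t Git k /= jk; exact: Git (leq_trans ij jk).
  have cG := nondecreasing_cvg_mu (mu := mu) mG (bigcupT_measurable _ mG) ndG.
  rewrite -(cvg_lim _ cG)//; apply: lime_le; first by apply/cvg_ex; eexists; exact: cG.
  apply: nearW => i /=; case: (HP i) => mH _; apply: le_trans.
  by apply: le_measure; rewrite ?inE// => t; apply => /=.
Qed.

Definition scheme_branch (T : Type) (A : seq nat -> set T) (t : T)
    (w : nat -> nat) : Prop := forall n, A (mkseq w n) t.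

Definition souslin (T : Type) (A : seq nat -> set T) : set T :=
  [set t | exists w, scheme_branch A t w].

(** [s] can be prolonged by [k] entries bounded by [b] so that [t] belongs to
    all the sets of the scheme met on the way. *)
Fixpoint viable (T : Type) (A : seq nat -> set T) (b : nat -> nat) (k : nat)
    (s : seq nat) : set T :=
  if k is k'.+1 then
    A s `&` \bigcup_(j in [set j | (j <= b (size s))%N]) viable A b k' (rcons s j)
  else A s.

(** The nodes that survive at all depths: by [extendible_rcons] these are the
    nodes through which a [b]-bounded branch passes. *)
Definition extendible (T : Type) (A : seq nat -> set T) (b : nat -> nat)
    (s : seq nat) : set T := \bigcap_k viable A b k s.

Lemma measurable_viable d (T : measurableType d) (A : seq nat -> set T) b k s :
  (forall s, measurable (A s)) -> measurable (viable A b k s).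
Proof.
move=> mA; elim: k s => [|k IH] s //=.
by apply: measurableI => //; apply: bigcup_measurable => j _; exact: IH.
Qed.

Lemma measurable_extendible d (T : measurableType d) (A : seq nat -> set T) b s :
  (forall s, measurable (A s)) -> measurable (extendible A b s).
Proof. by move=> mA; apply: bigcapT_measurable => k; exact: measurable_viable. Qed.

Lemma viableW (T : Type) (A : seq nat -> set T) b k k' s : (k <= k')%N ->
  viable A b k' s `<=` viable A b k s.
Proof.
elim: k k' s => [|k IH] [|k'] s kk' t //=; first by move=> [].
by case=> As [j jb Vj]; split => //; exists j => //; exact: IH Vj.
Qed.

Lemma branch_viable (T : Type) (A : seq nat -> set T) b w t n k :
  scheme_branch A t w -> (forall i, (i < n + k)%N -> (w i <= b i)%N) ->
  viable A b k (mkseq w n) t.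
Proof.
move=> tw; elim: k n => [|k IH] n wb /=; first exact: tw.
split; first exact: tw.
exists (w n); first by rewrite /= size_mkseq; apply: wb; rewrite addnS ltnS leq_addr.
by rewrite -mkseqS; apply: IH => i; rewrite addSnnS; exact: wb.
Qed.

(** Koenig's lemma: if each of the finitely many children died at some depth,
    the node itself would die one level below the largest of these depths. *)
Lemma extendible_rcons (T : Type) (A : seq nat -> set T) b s t :
  extendible A b s t ->
  exists2 j, (j <= b (size s))%N & extendible A b (rcons s j) t.
Proof.
move=> Kt; apply: contrapT => noj.
have /choice[f fP] : forall j, exists k, (j <= b (size s))%N ->
    ~ viable A b k (rcons s j) t.
  move=> j; have [jb|] := pselect (j <= b (size s))%N; last by exists 0%N.
  apply: contrapT => nok; apply: noj; exists j => // k _.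
  by apply: contrapT => nV; apply: nok; exists k.
pose N := (\max_(j < (b (size s)).+1) f j)%N.
have [_ [j /= jb Vj]] := Kt N.+1 I.
apply: (fP j jb); apply: viableW Vj.
have jb' : (j < (b (size s)).+1)%N by [].
exact: (@leq_bigmax _ (fun j : 'I_(b (size s)).+1 => f j) (Ordinal jb')).
Qed.

Definition least (P : set nat) : nat :=
  xget 0%N [set j | P j /\ forall i, (i < j)%N -> ~ P i].

Lemma leastP (P : set nat) : (exists j, P j) ->
  P (least P) /\ forall i, (i < least P)%N -> ~ P i.
Proof.
move=> [j0 Pj0]; rewrite /least.
case: xgetP => [_ _ //|none].
have exP : exists j, `[< P j >] by exists j0; apply/asboolP.
case: (ex_minnP exP) => j /asboolP Pj minj; exfalso; apply: (none j); split => // i ij Pi.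
by move: (minj i); rewrite leqNgt ij => /(_ (asboolT Pi)).
Qed.

Lemma least_le (P : set nat) j : P j -> (least P <= j)%N.
Proof.
move=> Pj; have [_ min] := leastP (ex_intro _ j Pj).
by rewrite leqNgt; apply/negP => /min.
Qed.

Lemma least_eq0 (P : set nat) : ~ (exists j, P j) -> least P = 0%N.
Proof. by move=> nP; rewrite /least; case: xgetP => // j _ [Pj _]; case: nP; exists j. Qed.

Lemma measurable_least d (T : measurableType d) (K : nat -> set T) j :
  (forall i, measurable (K i)) -> measurable [set t | least [set i | K i t] = j].
Proof.
move=> mK.
(* The default value of [least] is 0, whence the extra term for [j = 0]. *)
pose first i := K i `&` \bigcap_(k in [set k | (k < i)%N]) ~` K k.
have mfirst i : measurable (first i).
  apply: measurableI => //; apply: bigcap_measurableType => k _.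
  exact: measurableC.
suff -> : [set t | least [set i | K i t] = j] =
    first j `|` (if j == 0%N then ~` \bigcup_i K i else set0).
  apply: measurableU => //; case: ifP => // _; apply: measurableC.
  exact: bigcupT_measurable.
apply/seteqP; split => [t /= ltj|t [[Kj Kn]|]] /=.
- have [ex|nex] := pselect (exists i, K i t).
    left; have := leastP ex; rewrite ltj => -[Kj Kn].
    by split => // i /= /Kn.
  right; move: ltj; rewrite (@least_eq0 [set i | K i t] nex) => <-; rewrite eqxx.
  by move=> [i _ Ki]; apply: nex; exists i.
- apply/eqP; rewrite eqn_leq least_le //=.
  have [Kl _] := @leastP [set i | K i t] (ex_intro _ j Kj).
  by rewrite leqNgt; apply/negP => /Kn /(_ Kl).
- case: eqP => // -> nK; apply: least_eq0 => -[i Ki].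
  by apply: nK; exists i.
Qed.

(** The least child is searched among all integers: a child allowed by [b]
    exists when the node is extendible, so the least one is allowed too. *)
Fixpoint leftmost (T : Type) (A : seq nat -> set T) (b : nat -> nat) (t : T)
    (n : nat) : seq nat :=
  if n is n'.+1 then
    let s := leftmost A b t n' in
    rcons s (least [set j | extendible A b (rcons s j) t])
  else [::].

Lemma size_leftmost (T : Type) (A : seq nat -> set T) b t n :
  size (leftmost A b t n) = n.
Proof. by elim: n => //= n IH; rewrite size_rcons IH. Qed.

Definition leftmost_branch (T : Type) (A : seq nat -> set T) (b : nat -> nat)
  (t : T) (n : nat) : nat := nth 0%N (leftmost A b t n.+1) n.

Lemma mkseq_leftmost_branch (T : Type) (A : seq nat -> set T) b t n :
  mkseq (leftmost_branch A b t) n = leftmost A b t n.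
Proof.
elim: n => // n IH; rewrite mkseqS IH /leftmost_branch /=.
by rewrite nth_rcons size_leftmost ltnn eqxx.
Qed.

Lemma measurable_leftmost d (T : measurableType d) (A : seq nat -> set T) b n s :
  (forall s, measurable (A s)) -> measurable [set t | leftmost A b t n = s].
Proof.
move=> mA; elim: n s => [|n IH] s /=.
  have [->|ns] := eqVneq s [::]; first by rewrite (_ : [set _ | _] = setT)// -subTset.
  by rewrite (_ : [set _ | _] = set0)// -subset0 => t /= /esym/eqP; rewrite (negbTE ns).
case/lastP: s => [|s j].
  rewrite (_ : [set _ | _] = set0)// -subset0 => t /= /(congr1 size).
  by rewrite size_rcons.
rewrite (_ : [set _ | _] = [set t | leftmost A b t n = s] `&`
    [set t | least [set i | extendible A b (rcons s i) t] = j]).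
  apply: measurableI => //; apply: (@measurable_least _ _ (fun i => extendible A b (rcons s i))).
  by move=> i; exact: measurable_extendible.
apply/seteqP; split => t /=.
  by move/rcons_inj => [<- <-].
by move=> [-> ->].
Qed.

Lemma leftmost_extendible (T : Type) (A : seq nat -> set T) b t n :
  extendible A b [::] t -> extendible A b (leftmost A b t n) t.
Proof.
move=> K0; elim: n => //= n IH.
have [j _ Kj] := extendible_rcons IH.
exact: (@leastP [set j | _] (ex_intro _ j Kj)).1.
Qed.

Lemma leftmost_branchP (T : Type) (A : seq nat -> set T) b t :
  extendible A b [::] t ->
  scheme_branch A t (leftmost_branch A b t) /\
  forall n, (leftmost_branch A b t n <= b n)%N.
Proof.
move=> K0; split => n.
  rewrite mkseq_leftmost_branch.
  exact: (leftmost_extendible n K0) 0%N I.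
rewrite /leftmost_branch /= nth_rcons size_leftmost ltnn eqxx.
have [j jb Kj] := extendible_rcons (leftmost_extendible n K0).
rewrite size_leftmost in jb; apply: leq_trans jb.
exact: (@least_le [set j | extendible A b (rcons _ j) t]).
Qed.

(** Only the first [size l] entries of the branch are constrained, which allows
    the bounds to be chosen one at a time. *)
Definition bounded_souslin (T : Type) (A : seq nat -> set T) (l : seq nat) : set T :=
  [set t | exists2 w, scheme_branch A t w &
     forall i, (i < size l)%N -> (w i <= nth 0%N l i)%N].

Lemma bounded_souslin_rcons (T : Type) (A : seq nat -> set T) (l : seq nat) :
  bounded_souslin A l = \bigcup_j bounded_souslin A (rcons l j).
Proof.
apply/seteqP; split => t.
  move=> [w tw wl]; exists (w (size l)) => //; exists w => // i.
  rewrite size_rcons ltnS leq_eqVlt nth_rcons => /orP[/eqP->|il].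
    by rewrite ltnn eqxx.
  by rewrite il; exact: wl.
move=> [j _ [w tw wl]]; exists w => // i il.
by have := wl i; rewrite size_rcons nth_rcons il => /(_ (ltnW _)); apply.
Qed.

(** Inner approximation of Souslin sets by bounded branches:
    each new bound can be taken large enough to keep the outer measure larger
    than [c], by [covered_bigcup].  The measurable set of points viable to depth
    [k] contains the bounded Souslin set at stage [k], so its measure exceeds
    [c]; these sets decrease to the set in the conclusion. *)
Lemma not_covered_extendible (R : realType) d (T : measurableType d)
    (mu : {measure set T -> \bar R}) (A : seq nat -> set T) (c : \bar R) :
  mu setT < +oo -> (forall s, measurable (A s)) ->
  ~ covered mu c (souslin A) ->
  exists b, c <= mu (extendible A b [::]).
Proof.
move=> finmu mA ncov.
(* The next bound: if no [j] worked, the increasing union would be covered. *)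
have step l : exists j, ~ covered mu c (bounded_souslin A l) ->
    ~ covered mu c (bounded_souslin A (rcons l j)).
  have [cl|ncl] := pselect (covered mu c (bounded_souslin A l)); first by exists 0%N.
  apply: contrapT => noj; apply: ncl; rewrite bounded_souslin_rcons.
  apply: covered_bigcup => [i j ij t [w tw wl]|j]; last first.
    by apply: contrapT => nc; apply: noj; exists j.
  exists w => // k; rewrite size_rcons => kl; apply: (leq_trans (wl k _)).
    by rewrite size_rcons.
  by rewrite !nth_rcons; case: ltnP => // _; case: eqP.
have [f fP] := choice step.
pose L := fix L n := if n is n'.+1 then rcons (L n') (f (L n')) else [::].
have sL n : size (L n) = n by elim: n => //= n IH; rewrite size_rcons IH.
have ncL n : ~ covered mu c (bounded_souslin A (L n)).
  elim: n => [|n IH] /=; last exact: fP.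
  move=> [H [mH SH Hc]]; apply: ncov; exists H; split => // t [w tw].
  by apply: SH; exists w.
pose b n := f (L n).
have nthL n i : (i < n)%N -> nth 0%N (L n) i = b i.
  elim: n => // n IH; rewrite ltnS leq_eqVlt /= nth_rcons sL => /orP[/eqP->|il].
    by rewrite ltnn eqxx.
  by rewrite il; exact: IH.
exists b.
have mV k : measurable (viable A b k [::]) by exact: measurable_viable.
have nV : nonincreasing_seq (fun k => viable A b k [::]).
  by move=> i j ij; apply/subsetPset; exact: viableW.
have cV := nonincreasing_cvg_mu (mu := mu) _ mV (bigcapT_measurable mV) nV.
have {}cV := cV (le_lt_trans (le_measure mu _ _ (@subsetT _ _)) finmu).
rewrite -(cvg_lim _ (cV _ _)) ?inE//; apply: lime_ge.
  by apply/cvg_ex; eexists; apply: cV; rewrite inE.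
apply: nearW => k /=; rewrite leNgt; apply/negP => Vc; apply: (ncL k).
exists (viable A b k [::]); split => //; last exact: ltW.
move=> t [w tw wl]; apply: (@branch_viable T A b w t 0 k) => // i.
by rewrite add0n => ik; rewrite -(nthL k i ik); apply: wl; rewrite sL.
Qed.

(** * Measurability of Souslin sets *)

Lemma extendible_souslin (T : Type) (A : seq nat -> set T) b :
  extendible A b [::] `<=` souslin A.
Proof.
by move=> t K0; exists (leftmost_branch A b t); case: (leftmost_branchP K0).
Qed.

(** Let [c] be the outer measure.  Measurable subsets of measure close to [c] come
    from [not_covered_extendible], measurable supersets from the definition of
    [c]; the union of the former and the intersection of the latter differ by a
    null set. *)
Lemma measurable_souslin (R : realType) d (T : measurableType d)
    (mu : {measure set T -> \bar R}) (A : seq nat -> set T) :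
  mu setT < +oo -> measure_is_complete mu -> (forall s, measurable (A s)) ->
  measurable (souslin A).
Proof.
move=> finmu cmu mA.
pose C := [set c : \bar R | covered mu c (souslin A)].
pose c := ereal_inf C.
have c0 : 0 <= c.
  by apply: le_ereal_inf_tmp => x [H [mH _ Hx]]; apply: le_trans Hx.
have cfin : c \is a fin_num.
  rewrite ge0_fin_numE//; apply: le_lt_trans finmu.
  by apply: ereal_inf_lbound; exists setT; split.
pose e n : \bar R := (n.+1%:R^-1)%:E.
have e0 n : 0 < e n by rewrite lte_fin invr_gt0.
have /choice[H HP] n : exists H,
    [/\ measurable H, souslin A `<=` H & mu H <= c + e n].
  have [x [H [mH SH Hx]] xc] : exists2 x, C x & x < c + e n.
    by apply: ereal_inf_lt; rewrite lteDl.
  by exists H; split => //; apply: (le_trans Hx); exact: ltW.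
have /choice[b bP] n : exists b, c - e n <= mu (extendible A b [::]).
  apply: not_covered_extendible => // cov.
  have : c <= c - e n by exact: ereal_inf_lbound.
  by rewrite leNgt lteBlDr// lteDl// e0.
pose K := \bigcup_n extendible A (b n) [::].
have mK : measurable K.
  by apply: bigcupT_measurable => n; exact: measurable_extendible.
have mH : measurable (\bigcap_n H n).
  by apply: bigcapT_measurable => n; case: (HP n).
have KS : K `<=` souslin A by move=> t [n _]; exact: extendible_souslin.
have SH : souslin A `<=` \bigcap_n H n.
  by move=> t St n _; case: (HP n) => _ + _; exact.
have cH : mu (\bigcap_n H n) <= c.
  apply/lee_addgt0Pr => x x0.
  have [n nx] : exists n, e n <= x%:E.
    have [n /= nx] := ltr_add_invr (R := R) (y := 0%R) (x := x) x0.
    by exists n; rewrite /e lee_fin; move: nx; rewrite add0r => /ltW.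
  apply: (@le_trans _ _ (c + e n)); last by rewrite leeD2l.
  case: (HP n) => mHn _; apply: le_trans; apply: le_measure; rewrite ?inE//.
  exact: bigcap_inf.
have cK : c <= mu K.
  apply/lee_addgt0Pr => x x0.
  have [n nx] : exists n, e n <= x%:E.
    have [n /= nx] := ltr_add_invr (R := R) (y := 0%R) (x := x) x0.
    by exists n; rewrite /e lee_fin; move: nx; rewrite add0r => /ltW.
  apply: (@le_trans _ _ (mu K + e n)); last by rewrite leeD2l.
  rewrite -leeBlDr//; apply: (le_trans (bP n)); apply: le_measure; rewrite ?inE//.
    exact: measurable_extendible.
  by move=> t Kt; exists n.
have finK : mu K \is a fin_num.
  by rewrite ge0_fin_numE//; apply: le_lt_trans finmu; apply: le_measure; rewrite ?inE.
have null : mu (\bigcap_n H n `\` K) = 0.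
  apply/eqP; rewrite eq_le measure_ge0 andbT measureD//; last first.
    by apply: le_lt_trans finmu; apply: le_measure; rewrite ?inE.
  rewrite (setIidr (subset_trans KS SH)) leeBlDr// add0e.
  exact: le_trans cK.
rewrite -(setDUK KS); apply: measurableU => //; apply: cmu.
exists (\bigcap_n H n `\` K); split => //; first exact: measurableD.
exact: setSD.
Qed.

(** No set of measure less than that of the space covers the whole space. *)
Lemma extendible_full (R : realType) d (T : measurableType d)
    (mu : {measure set T -> \bar R}) (A : seq nat -> set T) (e : R) :
  mu setT < +oo -> (forall s, measurable (A s)) -> souslin A = setT ->
  (0 < e)%R -> exists b, mu (~` extendible A b [::]) <= e%:E.
Proof.
move=> finmu mA full e0.
have fmu : mu setT \is a fin_num by rewrite ge0_fin_numE.
have [|b bP] := @not_covered_extendible _ _ _ mu A (mu setT - e%:E) finmu mA.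
  move=> [H [mH]]; rewrite full subTset => ->.
  by rewrite leNgt lteBlDr// lteDl// lte_fin e0.
exists b; have mK := measurable_extendible b [::] mA.
have fK : mu (extendible A b [::]) \is a fin_num.
  by rewrite ge0_fin_numE//; apply: le_lt_trans finmu; apply: le_measure; rewrite ?inE.
rewrite -setTD measureD// setTI leeBlDr// addeC -leeBlDr//.
Qed.

(** * Graphs over the Baire space *)

(** A total inverse of [pickle] on pairs, with an arbitrary value off the codes of pairs. *)
Definition unpair (k : nat) : nat * nat := odflt (0, 0)%N (unpickle k).

Lemma unpairK p : unpair (pickle p) = p.
Proof. by rewrite /unpair pickleK. Qed.

Lemma take_mkseq (f : nat -> nat) n m : (n <= m)%N ->
  take n (mkseq f m) = mkseq f n.
Proof. by move=> nm; rewrite /mkseq -map_take take_iota (minn_idPl nm). Qed.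

(** The graph is the projection of a set that is closed in the Baire
    coordinates: the auxiliary sequence [be] is what makes the class stable
    under countable unions. *)
Definition souslin_graph d (T : measurableType d) (E : set (T * (nat -> nat))) : Prop :=
  exists2 A : seq nat -> seq nat -> set T, (forall s u, measurable (A s u)) &
    forall t al, E (t, al) <-> exists be, forall n, A (mkseq al n) (mkseq be n) t.

Section souslin_graph_closure.
Context d (T : measurableType d).

Lemma souslin_graph_fst (B : set T) : measurable B ->
  souslin_graph [set p : T * (nat -> nat) | B p.1].
Proof.
move=> mB; exists (fun _ _ => B) => // t al /=; split=> [Bt|[_ /(_ 0%N)]//].
by exists (fun=> 0%N).
Qed.

Lemma souslin_graph_closed (P : seq nat -> Prop) :
  souslin_graph [set p : T * (nat -> nat) | forall n, P (mkseq p.2 n)].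
Proof.
exists (fun s _ => [set t | P s]) => [s u|t al /=].
  have [Ps|nPs] := pselect (P s).
    by rewrite (_ : [set _ | _] = setT)// -subTset.
  by rewrite (_ : [set _ | _] = set0)// -subset0.
by split=> [PP|[_]//]; exists (fun=> 0%N).
Qed.

(** The first entry of the auxiliary sequence records the index of the union. *)
Lemma souslin_graph_bigcup (E : nat -> set (T * (nat -> nat))) :
  (forall i, souslin_graph (E i)) -> souslin_graph (\bigcup_i E i).
Proof.
move=> sE.
have /choice[A AP] : forall i, exists A : seq nat -> seq nat -> set T,
    (forall s u, measurable (A s u)) /\
    forall t al, E i (t, al) <-> exists be, forall n, A (mkseq al n) (mkseq be n) t.
  by move=> i; case: (sE i) => A mA EA; exists A.
exists (fun s u => if u is i :: u' then A i (take (size u') s) u' else setT).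
  by move=> s [//|i u]; case: (AP i).
have mkS (be : nat -> nat) n : mkseq be n.+1 = be 0%N :: mkseq (be \o S) n.
  by rewrite /mkseq /= (iotaDl 1 0) -map_comp.
move=> t al; split=> [[i _ /(AP i).2[be beP]]|[be beP]].
  exists (fun n => if n is n'.+1 then be n' else i) => -[//|n].
  by rewrite mkS size_mkseq take_mkseq//=.
exists (be 0%N) => //; apply/(AP _).2; exists (be \o S) => n.
move: (mkseq be n.+1) (mkS be n) (beP n.+1) => u ->.
by rewrite size_mkseq take_mkseq.
Qed.

(** One auxiliary sequence encodes all the sequences for the sets [E i], entry
    [j] of the [i]-th one being stored at the code of [(i, j)].  A finite prefix
    of it determines only some entries, so the new scheme imposes, at each
    length, those conditions that are already decided. *)
Lemma souslin_graph_bigcap (E : nat -> set (T * (nat -> nat))) :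
  (forall i, souslin_graph (E i)) -> souslin_graph (\bigcap_i E i).
Proof.
move=> sE.
have /choice[A AP] : forall i, exists A : seq nat -> seq nat -> set T,
    (forall s u, measurable (A s u)) /\
    forall t al, E i (t, al) <-> exists be, forall n, A (mkseq al n) (mkseq be n) t.
  by move=> i; case: (sE i) => A mA EA; exists A.
(* [ok s u i n]: the prefixes [s] and [u] are long enough to read the first
   [n] entries of [al] and of the [i]-th auxiliary sequence. *)
pose ok (s u : seq nat) (i n : nat) := (n <= size s)%N /\
  forall j, (j < n)%N -> (pickle (i, j) < size u)%N.
pose slice (u : seq nat) (i n : nat) := mkseq (fun j => nth 0%N u (pickle (i, j))) n.
exists (fun s u => \bigcap_i \bigcap_(n in ok s u i) A i (take n s) (slice u i n)).
  move=> s u; apply: bigcapT_measurable => i; apply: bigcap_measurableType => n _.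
  by case: (AP i).
have sliceE (be : nat -> nat) i n N :
    (forall j, (j < n)%N -> (pickle (i, j) < N)%N) ->
    slice (mkseq be N) i n = mkseq (fun j => be (pickle (i, j))) n.
  move=> okn; apply/eq_in_map => j; rewrite mem_iota add0n => /= jn.
  by rewrite nth_mkseq// okn.
move=> t al; split=> [Et|[be beP] i _].
  have /choice[be beP] i : exists be, forall n, A i (mkseq al n) (mkseq be n) t.
    by apply/(AP i).2; exact: Et.
  exists (fun k => be (unpair k).1 (unpair k).2) => N i _ n.
  rewrite /ok /= !size_mkseq => -[nN okn].
  rewrite take_mkseq// sliceE//.
  rewrite [X in A _ _ X](@eq_mkseq _ _ (be i))//.
  by move=> j; rewrite unpairK.
apply/(AP i).2; exists (fun j => be (pickle (i, j))) => n.
pose N := maxn n (\max_(j < n) (pickle (i, nat_of_ord j)).+1)%N.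
have okn j : (j < n)%N -> (pickle (i, j) < N)%N.
  move=> jn; rewrite /N leq_max; apply/orP; right.
  exact: (@leq_bigmax _ (fun j : 'I_n => (pickle (i, nat_of_ord j)).+1) (Ordinal jn)).
have := beP N i I n; rewrite /ok /= !size_mkseq sliceE// take_mkseq ?leq_maxl//.
by apply; split=> //; exact: okn.
Qed.

Lemma souslin_graph_open (P : seq nat -> Prop) :
  souslin_graph [set p : T * (nat -> nat) | exists n, P (mkseq p.2 n)].
Proof.
rewrite (_ : [set _ | _] = \bigcup_k [set p : T * (nat -> nat) |
    forall n, (fun s => size s = k -> P s) (mkseq p.2 n)]).
  by apply: souslin_graph_bigcup => k; exact: (souslin_graph_closed (fun s => size s = k -> P s)).
apply/seteqP; split => -[t al] /= [k].
  by move=> Pk; exists k => // n /=; rewrite size_mkseq => ->.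
by move=> _ /(_ k); rewrite size_mkseq => /(_ erefl); exists k.
Qed.

(** Souslin graphs are not stable under complement; requiring the property for
    both a set and its complement yields a sigma-algebra. *)
Definition bisouslin_graph (E : set (T * (nat -> nat))) : Prop :=
  souslin_graph E /\ souslin_graph (~` E).

Lemma bisouslin_graph_bigcup (E : nat -> set (T * (nat -> nat))) :
  (forall i, bisouslin_graph (E i)) -> bisouslin_graph (\bigcup_i E i).
Proof.
move=> bE; split; first by apply: souslin_graph_bigcup => i; case: (bE i).
by rewrite setC_bigcup; apply: souslin_graph_bigcap => i; case: (bE i).
Qed.

Lemma bisouslin_graphC (E : set (T * (nat -> nat))) :
  bisouslin_graph E -> bisouslin_graph (~` E).
Proof. by move=> [? ?]; split; rewrite ?setCK. Qed.

Lemma bisouslin_graph_fst (B : set T) : measurable B ->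
  bisouslin_graph [set p : T * (nat -> nat) | B p.1].
Proof.
move=> mB; split; first exact: souslin_graph_fst.
by apply: (@souslin_graph_fst (~` B)); exact: measurableC.
Qed.

Lemma bisouslin_graph_open (P : seq nat -> Prop) :
  bisouslin_graph [set p : T * (nat -> nat) | exists n, P (mkseq p.2 n)].
Proof.
split; first exact: souslin_graph_open.
rewrite (_ : ~` _ = [set p : T * (nat -> nat) | forall n, (fun s => ~ P s) (mkseq p.2 n)]).
  exact: (souslin_graph_closed (fun s => ~ P s)).
by apply/seteqP; split => -[t al] /= /forallNP.
Qed.

End souslin_graph_closure.

(** Continuity for the product topology on [nat -> nat], in the combinatorial
    form that fits Souslin schemes. *)
Definition prefix_continuous (X : topologicalType) (g : (nat -> nat) -> X) : Prop :=
  forall al (U : set X), open U -> U (g al) ->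
    exists n, forall al', mkseq al' n = mkseq al n -> U (g al').

(** Open sets generate the Borel sets of [X], and the pullback of an open set is
    a union of cylinders, that is, a condition of the form: some finite prefix
    of [al] forces [g al] into the open set. *)
Lemma bisouslin_graph_preimage d (T : measurableType d) (X : ptopologicalType)
    (g : (nat -> nat) -> X) (G : set (T * borelType X)) :
  prefix_continuous g -> measurable G ->
  bisouslin_graph [set p : T * (nat -> nat) | G (p.1, g p.2)].
Proof.
move=> cg; rewrite /measurable /=.
pose pull (G : set (T * X)) := [set p : T * (nat -> nat) | G (p.1, g p.2)].
have pullC G' : pull (~` G') = ~` pull G' by [].
have pull_bigcup (F : nat -> set (T * X)) : pull (\bigcup_i F i) = \bigcup_i pull (F i) by [].
have set0_bi : bisouslin_graph (set0 : set (T * (nat -> nat))).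
  exact: (@bisouslin_graph_fst _ _ set0).
apply: (@smallest_sub _ _ _ (fun G' => bisouslin_graph (pull G'))).
  split => [|A bA|F bF]; first exact: set0_bi.
  - by rewrite setTD; exact: bisouslin_graphC.
  - by rewrite pull_bigcup; exact: bisouslin_graph_bigcup.
rewrite subUset; split => _ [B mB <-]; rewrite setTI.
  exact: (@bisouslin_graph_fst _ _ B).
move: B mB; apply: smallest_sub.
  split => [|A bA|F bF]; first exact: set0_bi.
  - by rewrite setTD; exact: (bisouslin_graphC bA).
  - by rewrite /= preimage_bigcup pull_bigcup; exact: bisouslin_graph_bigcup.
move=> U oU /=.
pose P s := forall al, mkseq al (size s) = s -> U (g al).
rewrite (_ : pull _ = [set p | exists n, P (mkseq p.2 n)]).
  exact: bisouslin_graph_open.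
apply/seteqP; split => -[t al]; rewrite /pull /=.
  by move=> /(cg _ _ oU)[n nP]; exists n => al'; rewrite size_mkseq; exact: nP.
by move=> [n]; apply; rewrite size_mkseq.
Qed.

(** Coding the pair [(al n, be n)] as one integer turns the projection of a
    Souslin graph into the Souslin set of an ordinary scheme, whose branches
    also return the point [al] above [t]. *)
Lemma souslin_graph_proj d (T : measurableType d) (E : set (T * (nat -> nat))) :
  souslin_graph E ->
  exists2 A : seq nat -> set T, (forall s, measurable (A s)) &
    (forall t w, scheme_branch A t w -> E (t, fun n => (unpair (w n)).1)) /\
    (forall t al, E (t, al) -> souslin A t).
Proof.
move=> [A mA EA].
exists (fun s => A [seq (unpair k).1 | k <- s] [seq (unpair k).2 | k <- s]) => //.
split => [t w tw|t al /EA[be beP]].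
  apply/EA; exists (fun n => (unpair (w n)).2) => n.
  by have := tw n; rewrite /mkseq -!map_comp.
exists (fun n => pickle (al n, be n)) => n.
by have := beP n; rewrite /mkseq -!map_comp; congr (A _ _ _);
  apply/eq_map => k /=; rewrite unpairK.
Qed.

(** * Projection and approximate selection *)

Lemma prefix_continuousP (X : topologicalType) (g : (nat -> nat) -> X) :
  prefix_continuous g -> continuous (g : prod_topology (fun=> nat) -> X).
Proof.
move=> cg al V; rewrite nbhsE => -[U [oU Ual] UV].
have [n nP] := cg al U oU Ual.
have near_coord i : nbhs (al : prod_topology (fun=> nat)) [set be | be i = al i].
  have := @proj_continuous nat (fun=> nat) i al [set k | k = al i].
  by apply; rewrite nbhs_principalE; exact/principal_filterP.
have agree := filter_forall (nbhs_filter _) (fun i : 'I_n => near_coord i).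
apply: filterS agree => be beal; apply/UV/nP/eq_in_map => i.
by rewrite mem_iota add0n => /= ilt; exact: (beal (Ordinal ilt)).
Qed.

(** Tychonoff's theorem for a product of finite sets. *)
Lemma compact_prefix_image (X : topologicalType) (g : (nat -> nat) -> X)
    (D : nat -> set nat) :
  prefix_continuous g -> (forall n, finite_set (D n)) ->
  compact (g @` [set al | forall n, D n (al n)]).
Proof.
move=> cg fD.
apply: (@continuous_compact (prod_topology (fun=> nat)) X).
  exact/continuous_subspaceT/prefix_continuousP.
apply: (@tychonoff nat (fun=> nat)) => n.
by apply: finite_compact; exact: fD.
Qed.

Lemma measurable_projection (R : realType) d (T : measurableType d)
    (mu : {measure set T -> \bar R}) (X : ptopologicalType)
    (g : (nat -> nat) -> X) (G : set (T * borelType X)) :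
  mu setT < +oo -> measure_is_complete mu ->
  prefix_continuous g -> range g = setT -> measurable G ->
  measurable [set t | exists x : X, G (t, x)].
Proof.
move=> finmu cmu cg sg mG.
have [sG _] := bisouslin_graph_preimage cg mG.
have [A mA [AG GA]] := souslin_graph_proj sG.
rewrite (_ : [set _ | _] = souslin A); first exact: measurable_souslin finmu cmu mA.
apply/seteqP; split => t /= [].
  move=> x Gx; have : range g x by rewrite sg.
  by move=> [al _ gx]; apply: (GA t al) => /=; rewrite gx.
by move=> w /AG; eexists; eassumption.
Qed.

(** The leftmost bounded branch, mapped to [X], is the selection.  Truncating it
    by [b] does not change it over [K] and keeps it in a compact set elsewhere,
    so that the whole range is relatively compact. *)
Lemma approximate_selection (R : realType) d (T : measurableType d)
    (mu : {measure set T -> \bar R}) (X : ptopologicalType)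
    (g : (nat -> nat) -> X) (G : set (T * borelType X)) (e : R) :
  mu setT < +oo -> hausdorff_space X ->
  prefix_continuous g -> range g = setT -> measurable G ->
  (forall t, exists x : X, G (t, x)) -> (0 < e)%R ->
  exists K (x : T -> X), [/\ measurable K, mu (~` K) <= e%:E, L0 x,
    compact (closure (range x)) & forall t, K t -> G (t, x t)].
Proof.
move=> finmu hX cg sg mG Gfull e0.
have [sG _] := bisouslin_graph_preimage cg mG.
have [A mA [AG GA]] := souslin_graph_proj sG.
have Afull : souslin A = setT.
  rewrite -subTset => t _; have [x Gx] := Gfull t.
  have : range g x by rewrite sg.
  by move=> [al _ gx]; apply: (GA t al) => /=; rewrite gx.
have [b bP] := extendible_full finmu mA Afull e0.
pose w t n := minn (leftmost_branch A b t n) (b n).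
pose x t := g (fun n => (unpair (w t n)).1).
exists (extendible A b [::]), x; split => //.
- exact: measurable_extendible.
- have mopen : forall U : set X, open U -> measurable (x @^-1` U).
    move=> U oU.
    (* [P u]: the truncation of [u] by [b] is a prefix that forces values in [U]. *)
    pose P u := forall al, mkseq al (size u) =
      mkseq (fun i => (unpair (minn (nth 0%N u i) (b i))).1) (size u) -> U (g al).
    have wE t n : mkseq (fun i => (unpair (w t i)).1) n =
        mkseq (fun i => (unpair (minn (nth 0%N (leftmost A b t n) i) (b i))).1) n.
      apply/eq_in_map => i; rewrite mem_iota add0n => /= ilt.
      by rewrite -mkseq_leftmost_branch nth_mkseq.
    rewrite (_ : _ @^-1` _ = \bigcup_u (if `[< P u >] then
        [set t | leftmost A b t (size u) = u] else set0)).
      apply: countable_bigcupT_measurable; first exact: countableP.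
      by move=> u; case: ifP => // _; exact: measurable_leftmost.
    apply/seteqP; split => t /=.
      move=> /(cg _ _ oU)[n nP]; exists (leftmost A b t n) => //.
      rewrite asboolT /= ?size_leftmost// => al; rewrite size_leftmost -wE.
      exact: nP.
    move=> [u _]; case: asboolP => // Pu /= tu; apply: Pu.
    by rewrite wE tu.
  move=> _ B mB; rewrite setTI; move: B mB.
  apply: smallest_sub => //; split => [|B mB|F mF].
  + by rewrite /= preimage_set0.
  + by rewrite /= setTD preimage_setC; exact: measurableC.
  + by rewrite /= preimage_bigcup; exact: bigcupT_measurable.
- pose D n := (fun k => (unpair k).1) @` `I_(b n).+1.
  have cD : compact (g @` [set al | forall n, D n (al n)]).
    apply: compact_prefix_image => // n; exact/finite_image/finite_II.
  apply: (subclosed_compact _ cD); first exact: closed_closure.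
  rewrite ((closure_id _).1 (compact_closed hX cD)).
  apply: closure_subset => _ [t _ <-]; exists (fun n => (unpair (w t n)).1) => //= n.
  by exists (w t n) => //=; rewrite ltnS geq_minr.
- move=> t Kt; have [tb lb] := leftmost_branchP Kt.
  have -> : x t = g (fun n => (unpair (leftmost_branch A b t n)).1).
    by congr g; apply/funext => n; rewrite /w (minn_idPl (lb n)).
  exact: (AG t _ tb).
Qed.

(** * Suslin spaces as continuous images of the Baire space *)

Section baire_parametrization.
Local Open Scope ring_scope.
Context (R : realType) (P : metricType R) (e : nat -> P).

Let r (n : nat) : R := 2 ^- n.

(** Follow the dense sequence [e] along the indices [al], refusing any step that
    is too long: every [al] then yields a Cauchy sequence, and its limit depends
    continuously on [al]. *)
Fixpoint filtered_walk (al : nat -> nat) (n : nat) : P :=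
  if n is n'.+1 then
    let p := filtered_walk al n' in
    if mdist p (e (al n)) < r n' then e (al n) else p
  else e (al 0%N).

Let r_gt0 n : 0 < r n. Proof. by rewrite /r invr_gt0 exprn_gt0. Qed.

Let rS n : r n = 2 * r n.+1.
Proof. by rewrite /r exprS invfM mulrA divff ?mul1r. Qed.

Lemma filtered_walk_step al n :
  mdist (filtered_walk al n) (filtered_walk al n.+1) < r n.
Proof. by rewrite /=; case: ifPn => // _; rewrite mdistxx. Qed.

Lemma filtered_walk_dist al n m : (n <= m)%N ->
  mdist (filtered_walk al n) (filtered_walk al m) <= 2 * r n - 2 * r m.
Proof.
elim: m => [|m IH]; first by rewrite leqn0 => /eqP ->; rewrite mdistxx subrr.
rewrite leq_eqVlt => /orP[/eqP <-|]; first by rewrite mdistxx subrr.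
rewrite ltnS => /IH nm.
apply: (le_trans (metric_triangle _ (filtered_walk al m) _)).
have := filtered_walk_step al m; have := rS m; lra.
Qed.

Lemma filtered_walk_dist_lt al n m : (n <= m)%N ->
  mdist (filtered_walk al n) (filtered_walk al m) < 2 * r n.
Proof. by move/(filtered_walk_dist al); have := r_gt0 m; lra. Qed.

Lemma filtered_walk_prefix al al' n : mkseq al n.+1 = mkseq al' n.+1 ->
  filtered_walk al n = filtered_walk al' n.
Proof.
elim: n => [[] /= ->//|n IH]; rewrite mkseqS [RHS]mkseqS => /eqP.
rewrite eqseq_rcons => /andP[/eqP eqn /eqP eqSn] /=.
by rewrite (IH eqn) eqSn.
Qed.

Let small_radius (x : R) : 0 < x -> exists n, 4 * r n < x.
Proof.
move=> x0; have [n nx] : exists n : nat, 4 / x < n%:R.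
  by exists (Num.bound (4 / x)); apply: archi_boundP; rewrite divr_ge0// ltW.
exists n; rewrite /r -ltr_pdivlMr ?invr_gt0 ?exprn_gt0// invrK.
rewrite -ltr_pdivrMl//; apply: (lt_trans _ (_ : n%:R < _)); first by rewrite mulrC.
by rewrite -natrX ltr_nat ltn_expl.
Qed.

Lemma filtered_walk_cauchy al : cauchy (filtered_walk al @ \oo).
Proof.
apply/cauchy_exP => x x0; have [n nx] := small_radius x0.
exists (filtered_walk al n); exists n => // m /= nm.
rewrite ballEmdist /=; apply: (lt_trans (filtered_walk_dist_lt al nm)).
have := r_gt0 n; lra.
Qed.

Lemma filtered_walk_lim al p : filtered_walk al @ \oo --> p ->
  forall n, mdist (filtered_walk al n) p <= 2 * r n.
Proof.
move=> cp n; apply/ler_addgt0Pr => x x0.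
have [m [nm mx]] : exists m, (n <= m)%N /\ mdist p (filtered_walk al m) < x.
  have := cp _ (nbhsx_ballx p x x0); rewrite ballEmdist => -[N _ NP].
  exists (maxn n N); split; first exact: leq_maxl.
  by apply: (NP (maxn n N)) => /=; exact: leq_maxr.
apply: (le_trans (metric_triangle _ (filtered_walk al m) _)).
rewrite (metric_sym (filtered_walk al m) p).
by have := filtered_walk_dist_lt al nm; lra.
Qed.

(** A point [p] is reached by taking [e (al n)] within [2 ^- n.+2] of [p]: no step
    is then refused. *)
Lemma polish_parametrization : complete_metric P -> dense (range e) ->
  exists g : (nat -> nat) -> P, prefix_continuous g /\ range g = setT.
Proof.
move=> cP dP.
have /choice[g gP] : forall al, exists p : P, filtered_walk al @ \oo --> p.
  by move=> al; apply: cP; exact: filtered_walk_cauchy.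
exists g; split.
  move=> al U oU Ug; have : nbhs (g al) U by exact: open_nbhs_nbhs.
  rewrite -nbhs_ballE => -[x /= x0]; rewrite ballEmdist => xU.
  have [n nx] := small_radius x0; exists n.+1 => al' al'P; apply: xU => /=.
  apply: (le_lt_trans (metric_triangle _ (filtered_walk al n) _)).
  rewrite metric_sym {2}(filtered_walk_prefix (esym al'P)).
  have := filtered_walk_lim (gP al) n; have := filtered_walk_lim (gP al') n; lra.
rewrite -subTset => p _.
have /choice[al alP] : forall n, exists k, mdist p (e k) < r n.+2.
  move=> n; have [|q [qp [k _ kq]]] := dP (ball p (r n.+2))^° _ (open_interior _).
    by exists p; exact: (nbhsx_ballx p _ (r_gt0 _)).
  by exists k; rewrite kq; have := interior_subset qp; rewrite ballEmdist.
exists al => //.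
have walkE n : filtered_walk al n = e (al n).
  elim: n => //= n ->; rewrite ifT//.
  apply: (le_lt_trans (metric_triangle _ p _)); rewrite metric_sym.
  have := alP n; have := alP n.+1; have := rS n; have := rS n.+1; have := rS n.+2.
  have := r_gt0 n.+3; lra.
apply/esym/mdist_positivity/eqP; rewrite eq_le mdist_ge0 andbT.
apply/ler_addgt0Pr => x x0; rewrite add0r; have [n nx] := small_radius x0.
apply: (le_trans (metric_triangle _ (e (al n)) _)).
have := alP n; have := filtered_walk_lim (gP al) n; rewrite walkE.
have := rS n; have := rS n.+1; have := r_gt0 n.+2; lra.
Qed.

End baire_parametrization.

Lemma suslin_parametrization (R : realType) (X : ptopologicalType) :
  suslin_space R X ->
  exists g : (nat -> nat) -> X, prefix_continuous g /\ range g = setT.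
Proof.
move=> [_ [P [cP [D cD dD] [f [cf sf]]]]].
have [p0 _ _] : range f point by rewrite sf.
have D0 : D !=set0.
  by have [||p [_ Dp]] := dD setT; [by exists p0|exact: openT|exists p].
have [e eD] : exists e : nat -> P, D `<=` range e.
  move: cD D0 => /countable_injP[c cinj] [q Dq].
  exists (fun n => xget q [set x | D x /\ c x = n]) => x Dx; exists (c x) => //.
  apply: xget_unique => // y [Dy cyx]; apply: cinj; rewrite ?inE//.
have [g [cg sg]] : exists g : (nat -> nat) -> P, prefix_continuous g /\ range g = setT.
  apply: (@polish_parametrization R P e cP).
  by move=> O O0 oO; have [x [Ox Dx]] := dD O O0 oO; exists x; split => //; exact: eD.
exists (f \o g); split.
  move=> al U oU Ufg; apply: (cg al (f @^-1` U)) => //.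
  by apply: open_comp => // x _; exact: cf.
by rewrite -sf -(image_comp g f) sg.
Qed.

(** * Weights, densities and monotonicity of the integral *)

(** If the sets [F n] of finite measure cover the space, take the sum of the
    [c n] times the indicator of [F n], where [c n] makes both the values and
    the integrals summable. *)
Lemma positive_integrable_weight (R : realType) d (T : measurableType d)
    (mu : {measure set T -> \bar R}) :
  sigma_finite [set: T] mu ->
  exists2 w : T -> R, forall t, (0 < w t)%R & mu.-integrable setT (EFin \o w).
Proof.
move=> [F TF FP].
(* The 1 in the denominator allows [F n] to be a null set. *)
pose c n : R := (1 / (2 ^ n.+1)%:R / (1 + fine (mu (F n))))%R.
have F0 n : (0 <= fine (mu (F n)))%R by exact: fine_ge0.
have c0 n : (0 < c n)%R.
  by rewrite /c !divr_gt0// ?ltr0n ?expn_gt0// ltr_pwDl.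
have cle n : (c n <= 1 / (2 ^ n.+1)%:R)%R.
  rewrite /c ler_pdivrMr ?ltr_pwDl// ler_peMr ?divr_ge0//.
  by rewrite lerDl.
have cF n : (c n)%:E * mu (F n) <= (1 / (2 ^ n.+1)%:R)%:E.
  have fF : mu (F n) \is a fin_num by rewrite ge0_fin_numE//; case: (FP n).
  rewrite -(fineK fF) -EFinM lee_fin /c mulrAC ler_pdivrMr ?ltr_pwDl//.
  by rewrite ler_wpM2l ?divr_ge0// lerDr.
pose f n (t : T) : \bar R := (c n * \1_(F n) t)%:E.
have f0 n t : 0 <= f n t by rewrite lee_fin mulr_ge0// ltW.
have mf n : measurable_fun setT (f n).
  apply/measurable_EFinP; apply: measurable_funM => //.
  by apply: measurable_indic; case: (FP n).
pose W t := \sum_(n <oo) f n t.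
have half : \sum_(n <oo) (1 / (2 ^ n.+1)%:R : R)%:E <= 1%:E.
  exact: (@epsilon_trick0 R 1 xpredT).
have W1 t : W t <= 1%:E.
  apply: (le_trans _ half); apply: lee_nneseries => n _; first by move=> _; exact: f0.
  rewrite lee_fin indicE; case: (t \in F n); first by rewrite mulr1.
  by rewrite mulr0 divr_ge0.
have W0 t : 0 < W t.
  have : setT t by [].
  rewrite TF => -[n _ Fnt].
  apply: (@lt_le_trans _ _ (\sum_(0 <= i < n.+1) f i t)); last first.
    by apply: nneseries_lim_ge => k _ _; exact: f0.
  rewrite big_nat_recr//=; apply: (@lt_le_trans _ _ (f n t)).
    by rewrite /f indicE mem_set// mulr1 lte_fin.
  by rewrite leeDr// sume_ge0.
have Wfin t : W t \is a fin_num.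
  by rewrite ge0_fin_numE ?(ltW (W0 t))//; apply: le_lt_trans (W1 t) _; rewrite ltry.
have mW : measurable_fun setT W.
  by apply: ge0_emeasurable_sum => // *; exact: f0.
exists (fine \o W).
  by move=> t; rewrite fine_gt0// W0 /= -ge0_fin_numE// ltW.
have -> : EFin \o (fine \o W) = W by apply/funext => t /=; rewrite fineK.
apply/integrableP; split => //.
under eq_integral do rewrite gee0_abs ?(ltW (W0 _))//.
rewrite /W integral_nneseries//.
apply: (@le_lt_trans _ _ 1%:E); last by rewrite ltry.
apply: (le_trans _ half); apply: lee_nneseries => n _.
  by move=> _; apply: integral_ge0 => t _; exact: f0.
rewrite /f; under eq_integral do rewrite EFinM.
have mF : measurable (F n) by case: (FP n).
rewrite ge0_integralZl_EFin ?(ltW (c0 n))//.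
- by rewrite integral_indic// setIT.
- exact/measurable_EFinP/measurable_indic.
Qed.

Section density.
Context (R : realType) d (T : measurableType d) (mu : {measure set T -> \bar R}).
Context (u : T -> \bar R) (measu : measurable_fun setT u) (u0 : forall t, 0 <= u t).

(** The proofs are arguments of the definition so that a measure structure can
    be attached to it. *)
Definition density_measure of measurable_fun setT u & (forall t, 0 <= u t) :=
  fun A : set T => \int[mu]_(t in A) u t.

Local Notation nu := (density_measure measu u0).

Let nu0 : nu set0 = 0. Proof. by rewrite /nu integral_set0. Qed.

Let nu_ge0 A : 0 <= nu A. Proof. exact: integral_ge0. Qed.

Let nu_sigma : semi_sigma_additive nu.
Proof. exact: semi_sigma_additive_nng_induced. Qed.

HB.instance Definition _ := isMeasure.Build _ _ _ nu nu0 nu_ge0 nu_sigma.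

Lemma density_complete : (forall t, 0 < u t) -> measure_is_complete mu ->
  measure_is_complete nu.
Proof.
move=> u_gt0 cmu A [N [mN N0 AN]]; apply: cmu; exists N; split => //.
have mun : measurable_fun N u by exact: measurable_funTS.
have absN : \int[mu]_(t in N) `|u t| = 0.
  by rewrite -[RHS]N0; apply: eq_integral => t _; rewrite gee0_abs.
have [B [mB B0 NB]] := (ae_eq_integral_abs mu mN mun).1 absN.
apply: measure_negligible => //; exists B; split => // t Nt.
by apply: NB => /= /(_ Nt) ut0; have := u_gt0 t; rewrite ut0 ltxx.
Qed.

End density.

(** The positive and the negative parts compare separately, and subtraction of
    extended reals is monotone, also at infinite values. *)
Lemma le_integral_fune (R : realType) d (T : measurableType d)
    (mu : {measure set T -> \bar R}) (f g : T -> \bar R) :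
  measurable_fun setT f -> measurable_fun setT g -> (forall t, f t <= g t) ->
  \int[mu]_t f t <= \int[mu]_t g t.
Proof.
move=> mf mg fg; rewrite integralE [leRHS]integralE; apply: leeB.
- apply: ge0_le_integral => //; [exact: measurable_funepos|exact: measurable_funepos|].
  by move=> t _; apply: (@funepos_le _ _ setT f g) => //; rewrite inE.
- apply: ge0_le_integral => //; [exact: measurable_funeneg|exact: measurable_funeneg|].
  by move=> t _; apply: (@funeneg_le _ _ setT f g) => //; rewrite inE.
Qed.

(** The positive part of the truncation is that of [p], and its negative part
    increases to that of [p] because [w > 0]. *)
Lemma integral_truncation_lt (R : realType) d (T : measurableType d)
    (mu : {measure set T -> \bar R}) (p : T -> \bar R) (w : T -> R) (b : R) :
  measurable_fun setT p -> mu.-integrable setT p^\+ ->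
  (forall t, (0 < w t)%R) -> measurable_fun setT w ->
  \int[mu]_t p t < b%:E ->
  exists n, \int[mu]_t maxe (p t) (- (n%:R * w t)%:E) < b%:E.
Proof.
move=> mp ip w0 mw pb; apply: contrapT => noex.
pose a n t := maxe (p t) (- (n%:R * w t)%:E).
have nw0 n t : (0 <= n%:R * w t)%R by rewrite mulr_ge0// ltW.
have ma n : measurable_fun setT (a n).
  apply: measurable_maxe => //; apply: measurableT_comp => //.
  by apply/measurable_EFinP; apply: measurable_funM.
have apos n : (a n)^\+ = p^\+.
  apply/funext => t; rewrite !funeposE /a -maxA; congr (maxe _ _).
  by apply/max_idPr; rewrite leeNl oppe0 lee_fin.
have aneg_le n m : (n <= m)%N -> forall t, (a n)^\- t <= (a m)^\- t.
  move=> nm t; apply: (@funeneg_le _ _ setT (a m) (a n)); rewrite ?inE// => s _.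
  by rewrite /a le_max2// leeN2 lee_fin ler_wpM2r ?ler_nat// ltW.
have cvg_aneg t : (a n)^\- t @[n --> \oo] --> p^\- t.
  case pt : (p t) => [r| |].
  - apply: cvg_near_cst; near=> n; rewrite !funenegE /a; congr maxe; congr -%E.
    apply/max_idPl; rewrite pt -EFinN lee_fin lerNl.
    rewrite -ler_pdivrMr//; near: n; exact: nbhs_infty_ger.
  - by apply: cvg_near_cst; near=> n; rewrite !funenegE /a pt maxye.
  - rewrite funenegE pt /= maxye; apply/cvgeyPge => A; near=> n.
    rewrite funenegE /a pt maxNye oppeK le_max; apply/orP; left.
    rewrite lee_fin -ler_pdivrMr//; near: n; exact: nbhs_infty_ger.
have ifin : \int[mu]_t p^\+ t \is a fin_num by exact: integrable_fin_num.
have mono := @cvg_monotone_convergence _ _ _ mu setT measurableT (fun n => (a n)^\-)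
  (fun n => measurable_funeneg (ma n)) (fun n t _ => funeneg_ge0 _ t)
  (fun t _ n m nm => aneg_le n m nm t).
have lim_aneg : (fun t => limn (fun n => (a n)^\- t)) = p^\-.
  by apply/funext => t; apply/cvg_lim => //; exact: cvg_aneg.
rewrite lim_aneg in mono.
have bound n : \int[mu]_t (a n)^\- t <= \int[mu]_t p^\+ t - b%:E.
  have : b%:E <= \int[mu]_t a n t.
    by rewrite leNgt; apply/negP => ab; apply: noex; exists n.
  rewrite integralE apos -(fineK ifin).
  case: (\int[mu]_t (a n)^\- t) => [r| |] //=; last by rewrite leNye.
  by rewrite -!EFinB !lee_fin; lra.
have : \int[mu]_t p^\- t <= \int[mu]_t p^\+ t - b%:E.
  rewrite -(cvg_lim _ mono)//; apply: lime_le; last exact: nearW.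
  by apply/cvg_ex; eexists; exact: mono.
move=> Ib; have If : \int[mu]_t p^\- t \is a fin_num.
  rewrite ge0_fin_numE; last exact: integral_ge0.
  by apply: le_lt_trans Ib _; rewrite -(fineK ifin) ltry.
move: pb; apply/negP; rewrite -leNgt integralE.
by rewrite leeBrDr// addeC -leeBrDr.
Unshelve. all: by end_near. Qed.

(** The infimum is smaller than [c] exactly on a projection. *)
Lemma measurable_ereal_inf_section (R : realType) d (T : measurableType d)
    (mu : {measure set T -> \bar R}) (X : ptopologicalType)
    (g : (nat -> nat) -> X) (h : T * X -> \bar R) :
  mu setT < +oo -> measure_is_complete mu ->
  prefix_continuous g -> range g = setT ->
  measurable_fun [set: T * borelType X] (h : T * borelType X -> \bar R) ->
  measurable_fun [set: T] (fun t => ereal_inf (range (fun x : X => h (t, x)))).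
Proof.
move=> finmu cmu cg sg mh mT.
apply: (measurability _ (ErealGenInftyO.measurableE R)) => //.
move=> _ [_ [c ->] <-]; rewrite setTI.
rewrite (_ : _ @^-1` _ = [set t | exists x : X, h (t, x) < c%:E]).
  apply: (measurable_projection finmu cmu cg sg (G := [set p | h p < c%:E])).
  by rewrite -[X in measurable X]setTI; exact: emeasurable_fun_infty_o.
apply/seteqP; split => t /=; rewrite in_itv /=.
  by move=> /ereal_inf_lt[_ [x _ <-] hx]; exists x.
move=> [x hx]; apply: le_lt_trans hx; apply: ereal_inf_lbound.
by exists x.
Qed.

Lemma integrable_funepos_le (R : realType) d (T : measurableType d)
    (mu : {measure set T -> \bar R}) (f g : T -> \bar R) :
  measurable_fun setT f -> (forall t, f t <= g t) ->
  mu.-integrable setT g^\+ -> mu.-integrable setT f^\+.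
Proof.
move=> mf fg; apply: le_integrable => //; first exact: measurable_funepos.
move=> t _; rewrite !gee0_abs//.
by apply: (@funepos_le _ _ setT f g) => //; rewrite inE.
Qed.

Lemma upper_integral_le (R : realType) d (T : measurableType d)
    (mu : {measure set T -> \bar R}) (f g : T -> \bar R) :
  measurable_fun setT f -> measurable_fun setT g -> (forall t, f t <= g t) ->
  upper_integral mu f <= upper_integral mu g.
Proof.
move=> mf mg fg; rewrite [leRHS]/upper_integral; case: ifPn => [ig|_]; last exact: leey.
rewrite /upper_integral (integrable_funepos_le mf fg ig).
exact: le_integral_fune.
Qed.

Lemma measure_exhaustion (R : realType) d (T : measurableType d)
    (mu : {measure set T -> \bar R}) (F : nat -> set T) (e : R) :
  mu setT < +oo -> (forall n, measurable (F n)) -> nondecreasing_seq F ->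
  \bigcup_n F n = setT -> (0 < e)%R -> exists n, mu (~` F n) <= e%:E.
Proof.
move=> finmu mF ndF FT e0; apply: contrapT => noex.
have mC n : measurable (~` F n) by exact: measurableC.
have niC : nonincreasing_seq (fun n => ~` F n).
  by move=> i j ij; apply/subsetPset/subsetC/subsetPset/ndF.
have C0 : \bigcap_n ~` F n = set0 by rewrite -setC_bigcup FT setCT.
have mC0 : measurable (\bigcap_n ~` F n) by rewrite C0.
have := nonincreasing_cvg_mu (mu := mu) (le_lt_trans _ finmu) mC mC0 niC.
rewrite C0 measure0 => /(_ _) cv.
have /cvg_lim : (mu \o (fun n => ~` F n)) @ \oo --> 0.
  by apply: cv; apply: le_measure; rewrite ?inE.
move=> lim0; have : e%:E <= limn (mu \o (fun n => ~` F n)).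
  apply: lime_ge; last first.
    by apply: nearW => n /=; rewrite leNgt; apply/negP => /ltW en; apply: noex; exists n.
  apply/cvg_ex; exists 0; apply: cv; apply: le_measure; rewrite ?inE//.
by rewrite lim0// leNgt lte_fin e0.
Qed.

(** * Interchange of infimum and integral *)

Lemma integral_truncation_fin (R : realType) d (T : measurableType d)
    (mu : {measure set T -> \bar R}) (p : T -> \bar R) (w : T -> R) (n : nat) :
  measurable_fun setT p -> mu.-integrable setT p^\+ ->
  (forall t, (0 < w t)%R) -> mu.-integrable setT (EFin \o w) ->
  mu.-integrable setT (fun t => maxe (p t) (- (n%:R * w t)%:E)).
Proof.
move=> mp ip w0 iw; have mw := measurable_int mu iw.
have inw : mu.-integrable setT (fun t => (n%:R * w t)%:E).
  exact: (integrableZl measurableT n%:R iw).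
apply: (le_integrable measurableT _ _ (integrableD measurableT ip inw)).
  by apply: measurable_maxe => //; apply: measurableT_comp => //; exact: measurable_int inw.
move=> t _; have nw0 : (0 <= n%:R * w t)%R by rewrite mulr_ge0// ltW.
rewrite [leRHS]gee0_abs ?adde_ge0// funeposE; move: (n%:R * w t)%R nw0 => c c0.
case: (p t) => [r| |] /=; rewrite ?maxye ?maxNye.
- rewrite -!EFin_max -EFinD lee_fin ler_norml /Num.max.
  by case: ltP => ?; case: ltP => ?; apply/andP; split; lra.
- by rewrite addye// leey.
- by rewrite add0e lee_fin normrN ger0_norm.
Qed.

(** Where [x0] is kept, [h (., x0)] exceeds the truncation [a] by at most its
    positive part plus [n w]; choosing that set small for the measure with
    density [u] makes the integral of both terms small. *)
Lemma near_optimal_selection (R : realType) (d : measure_display) (T : measurableType d)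
    (m : {measure set T -> \bar R}) (X : ptopologicalType)
    (g : (nat -> nat) -> X) (h : T * X -> \bar R) (XX : set (T -> X))
    (x0 : T -> X) (w : T -> R) (b : R) :
  measure_is_complete m -> sigma_finite [set: T] m -> hausdorff_space X ->
  prefix_continuous g -> range g = setT ->
  measurable_fun [set: T * borelType X] (h : T * borelType X -> \bar R) ->
  XX `<=` @L0 d T X -> decomposable m XX -> XX x0 ->
  m.-integrable setT (fun t => h (t, x0 t))^\+ ->
  (forall t, (0 < w t)%R) -> m.-integrable setT (EFin \o w) ->
  measurable_fun setT (fun t => ereal_inf (range (fun x : X => h (t, x)))) ->
  \int[m]_t ereal_inf (range (fun x : X => h (t, x))) < b%:E ->
  exists2 x, XX x & upper_integral m (fun t => h (t, x t)) <= b%:E.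
Proof.
move=> cm /sigma_finiteP[F [TF ndF FP]] hX cg sg mh XXL0 XXdec XXx0 ih0 w0 iw mp pb.
have mF n : measurable (F n) by case: (FP n).
set p := (fun t => _) in mp pb.
have mhx x : L0 x -> measurable_fun setT (fun t => h (t, x t)).
  move=> mx; apply: (measurableT_comp mh).
  exact: (@measurable_fun_pair _ _ _ T T (borelType X)).
have mw := measurable_int m iw.
have p_le x t : p t <= h (t, x) by apply: ereal_inf_lbound; exists x.
have ip : m.-integrable setT p^\+.
  by apply: integrable_funepos_le ih0 => // t; exact: p_le.
have [n anb] := integral_truncation_lt mp ip w0 ((measurable_EFinP _ _).1 mw) pb.
set a := (fun t => maxe (p t) (- (n%:R * w t)%:E)) in anb.
have ia : m.-integrable setT a by exact: integral_truncation_fin.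
have ma := measurable_int m ia.
have fa : \int[m]_t a t \is a fin_num by exact: integrable_fin_num.
have fw : \int[m]_t (w t)%:E \is a fin_num by exact: integrable_fin_num.
have w_ge0 : (0 <= fine (\int[m]_t (w t)%:E))%R.
  by apply: fine_ge0; apply: integral_ge0 => t _; rewrite lee_fin ltW.
pose gap : R := (b - fine (\int[m]_t a t))%R.
have gap0 : (0 < gap)%R by rewrite /gap subr_gt0 -lte_fin fineK.
(* The integrals of [e w] and of [n.+1 u] off [A] are to be at most half the gap each. *)
pose e : R := (gap / 2 / (1 + fine (\int[m]_t (w t)%:E)))%R.
pose dl : R := (gap / 4 / n.+1%:R)%R.
have e0 : (0 < e)%R by rewrite /e !divr_gt0// ltr_pwDl.
have dl0 : (0 < dl)%R by rewrite /dl !divr_gt0.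
pose u t := (fun t => h (t, x0 t))^\+ t + (w t)%:E.
have iu : m.-integrable setT u by exact: integrableD.
have measu := measurable_int m iu.
have u0 t : 0 < u t by apply: (@lt_le_trans _ _ (w t)%:E); [rewrite lte_fin|rewrite leeDr].
have u_ge0 t : 0 <= u t by exact: ltW.
pose nu : {measure set T -> \bar R} := density_measure m measu u_ge0.
have nuE A : nu A = \int[m]_(t in A) u t by [].
have finnu : nu setT < +oo.
  rewrite nuE; have : \int[m]_t u t \is a fin_num by exact: integrable_fin_num.
  by rewrite ge0_fin_numE// integral_ge0.
pose q t := a t + (e * w t)%:E.
have mq : measurable_fun setT q.
  apply: emeasurable_funD => //.
  by apply/measurable_EFinP; apply: measurable_funM => //; exact/measurable_EFinP.
pose G := [set z : T * borelType X | h z <= q z.1].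
have mG : measurable G.
  rewrite -[G]setTI; apply: (measurable_lee measurableT mh).
  exact: (measurableT_comp mq).
have Gfull t : exists x : X, G (t, x).
  rewrite /G /=; have [py|py] := eqVneq (p t) +oo.
    by exists point; rewrite /q /a py maxye addye// leey.
  have : p t < q t.
    rewrite /q /a; case: (p t) py => [r| |] // _.
      apply: (@lt_le_trans _ _ (r%:E + (e * w t)%:E)); last first.
        by rewrite leeD2r// le_max lexx.
      by rewrite lteDl// lte_fin mulr_gt0.
    by rewrite maxNye -EFinN -EFinD ltNyr.
  by move=> /ereal_inf_lt[_ [x _ <-] /ltW hx]; exists x.
have [K [xb [mK nuK L0xb cxb GK]]] :=
  approximate_selection finnu hX cg sg mG Gfull dl0.
have [j nuF] := measure_exhaustion finnu mF ndF (esym TF) dl0.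
(* Intersecting with [F j] makes the measure of the pasting set finite. *)
pose A := K `&` F j.
have mA : measurable A by exact: measurableI.
have mA_fin : m A < +oo.
  by case: (FP j) => _; apply: le_lt_trans; apply: le_measure; rewrite ?inE//; exact: subIsetr.
have nuA : nu (~` A) <= (dl + dl)%:E.
  rewrite setCI; apply: (le_trans (measureU2 _ _ _)); [exact: measurableC..|].
  by rewrite EFinD leeD.
pose x := patch x0 A xb.
have XXx : XX x by exact: XXdec.
exists x => //.
pose s t := (e * w t)%:E + n.+1%:R%:E * (u \_ (~` A)) t.
have iuA : m.-integrable setT (u \_ (~` A)).
  apply/(integrable_mkcond _ (measurableC mA)).1.
  by apply: (integrableS measurableT _ _ iu) => //; exact: measurableC.
have ie : m.-integrable setT (fun t => (e * w t)%:E).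
  exact: (integrableZl measurableT e iw).
have inu : m.-integrable setT (fun t => n.+1%:R%:E * (u \_ (~` A)) t).
  exact: (integrableZl measurableT n.+1%:R iuA).
have is_ : m.-integrable setT s by exact: integrableD.
have ir : m.-integrable setT (fun t => a t + s t) by exact: integrableD.
have mf := mhx _ (XXL0 _ XXx).
have fr t : h (t, x t) <= a t + s t.
  rewrite /s /x /patch in_setC; have [tA|tA] /= := boolP (t \in A).
    have [Kt _] := set_mem tA.
    by rewrite mule0 adde0; exact: (GK t Kt).
  (* Off [A]: [a >= - n w], and [n.+1 u] compensates [n w] and exceeds [h (., x0)]. *)
  apply: (@le_trans _ _ (- (n%:R * w t)%:E + ((e * w t)%:E + n.+1%:R%:E * u t))).
    have ew0 : (0 <= e * w t)%R by rewrite mulr_ge0// ltW.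
    have wt0 := w0 t.
    rewrite /u funeposE; case: (h (t, x0 t)) => [r| |] /=.
    - rewrite -EFin_max /= lee_fin -natr1.
      have M0 : (0 <= n%:R * Num.max r 0)%R by rewrite mulr_ge0// le_max lexx orbT.
      have rM : (r <= Num.max r 0)%R by rewrite le_max lexx.
      by move: (Num.max r 0)%R M0 rM => M M0 rM; lra.
    - by rewrite maxye addye// gt0_muley ?lte_fin ?ltr0n// addey// addey// leey.
    - by rewrite leNye.
  by rewrite leeD2r// /a le_max lexx orbT.
rewrite /upper_integral.
rewrite (integrable_funepos_le mf fr (integrable_funepos measurableT ir)) /=.
apply: (le_trans (le_integral_fune m mf (measurable_int m ir) fr)).
rewrite integralD// [X in _ + X]integralD//.
rewrite (integralZl measurableT iw e) (integralZl measurableT iuA n.+1%:R).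
rewrite -integral_mkcond -nuE.
have nufin : nu (~` A) \is a fin_num.
  by rewrite ge0_fin_numE//; apply: le_lt_trans nuA _; rewrite ltry.
rewrite -(fineK fa) -(fineK fw) -(fineK nufin) -!EFinM -!EFinD lee_fin.
have nuA' : (fine (nu (~` A)) <= dl + dl)%R by rewrite -lee_fin fineK.
have {}nuA' : (n.+1%:R * fine (nu (~` A)) <= gap / 2)%R.
  apply: (@le_trans _ _ (n.+1%:R * (dl + dl))%R); first by rewrite ler_wpM2l.
  by rewrite /dl -mulrDl mulrC divfK ?pnatr_eq0//; lra.
have eI : (e * fine (\int[m]_t (w t)%:E) <= gap / 2)%R.
  rewrite /e mulrAC ler_pdivrMr ?ltr_pwDl// ler_wpM2l ?divr_ge0 ?ltW//.
  by rewrite ltrDr.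
by move: nuA' eI; rewrite /gap; lra.
Qed.

Theorem theorem1 (R : realType) (d : measure_display) (Xi : measurableType d)
    (m : {measure set Xi -> \bar R}) (X : ptopologicalType)
    (m_complete : measure_is_complete m)
    (m_sigma_finite : sigma_finite [set: Xi] m)
    (X_suslin : suslin_space R X)
    (h : Xi * X -> \bar R)
    (h_meas : measurable_fun [set: Xi * borelType X]
                (h : Xi * borelType X -> \bar R))
    (XX : set (Xi -> X))
    (XX_L0 : XX `<=` @L0 d Xi X)
    (XX_dec : decomposable m XX) :
  ereal_inf [set upper_integral m (fun xi => h (xi, x xi)) | x in XX] < +oo ->
  measurable_fun [set: Xi] (fun xi => ereal_inf (range (fun x : X => h (xi, x))))
  /\
  ereal_inf [set upper_integral m (fun xi => h (xi, x xi)) | x in XX]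
  = upper_integral m (fun xi => ereal_inf (range (fun x : X => h (xi, x)))).
Proof.
move=> inf_lty.
have [g [cg sg]] := suslin_parametrization X_suslin.
have [w w0 iw] := positive_integrable_weight m_sigma_finite.
have mp : measurable_fun [set: Xi]
    (fun xi => ereal_inf (range (fun x : X => h (xi, x)))).
  have mw := measurable_int m iw.
  have w_ge0 t : 0 <= (EFin \o w) t by rewrite lee_fin ltW.
  have cnu := @density_complete _ _ _ m _ mw w_ge0 w0 m_complete.
  apply: (measurable_ereal_inf_section _ cnu cg sg h_meas).
  have : \int[m]_t (w t)%:E \is a fin_num by exact: integrable_fin_num.
  by rewrite ge0_fin_numE//; apply: integral_ge0 => t _; exact: w_ge0.
split => //.
have [_ [x0 XXx0 <-] ux0] := ereal_inf_lt inf_lty.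
have ih0 : m.-integrable setT (fun xi => h (xi, x0 xi))^\+.
  by move: ux0; rewrite /upper_integral; case: ifPn; rewrite ?ltxx.
have mhx x : XX x -> measurable_fun setT (fun xi => h (xi, x xi)).
  move=> XXx; apply: (measurableT_comp h_meas).
  exact: (@measurable_fun_pair _ _ _ Xi Xi (borelType X) _ _ _ (XX_L0 _ XXx)).
have p_le x t : ereal_inf (range (fun y : X => h (t, y))) <= h (t, x).
  by apply: ereal_inf_lbound; exists x.
apply/eqP; rewrite eq_le; apply/andP; split; last first.
  apply: le_ereal_inf_tmp => _ [x XXx <-].
  by apply: upper_integral_le => //; exact: mhx.
rewrite leNgt; apply/negP.
rewrite {1}/upper_integral (integrable_funepos_le mp _ ih0)//= => gap.
have [b [pb bl]] : exists b : R,
    \int[m]_xi ereal_inf (range (fun x : X => h (xi, x))) < b%:E /\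
    b%:E < ereal_inf [set upper_integral m (fun xi => h (xi, x xi)) | x in XX].
  move: gap inf_lty; set I := ereal_inf _; set P := \int[m]_xi _.
  case: I => [r| |]; case: P => [s| |] //.
  - rewrite lte_fin => sr _; exists ((s + r) / 2)%R.
    by rewrite !lte_fin; split; lra.
  - by move=> _ _; exists (r - 1)%R; rewrite ltNyr lte_fin; split => //; lra.
have [x XXx xb] := near_optimal_selection m_complete m_sigma_finite X_suslin.1
  cg sg h_meas XX_L0 XX_dec XXx0 ih0 w0 iw mp pb.
move: bl; apply/negP; rewrite -leNgt; apply: le_trans xb.
by apply: ereal_inf_lbound; exists x.
Qed.
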